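(* Let $\Bbbk$ be a field and let $\mathcal{Y}=\{\alpha_1<\alpha_2<\alpha_3\}$ be a linearly ordered set with three elements, endowed with an involution $\sigma$ such that $\sigma(\alpha_3)=\alpha_3$ and either $\sigma(\alpha_i)=\alpha_i$ for $i=1,2$, or $\sigma(\alpha_1)=\alpha_2$. Then the category $s(\mathcal{Y},\Bbbk)$ is not abelian.
   Context: **Block matrices.** For a block matrix $B=(B_i^j)_{i,j\in\mathcal{Y}}$ with entries in $\Bbbk$ (blocks not necessarily square, possibly empty), the subindex denotes the block row and the superindex the block column; $B_i$ is the $i$-th horizontal band and $B^j$ the $j$-th vertical band. A horizontal partition of $C$ is compatible with the vertical partition of $D$ if for each $x\in\mathcal{Y}$ the number of rows of $C_x$ equals the number of columns of $D^x$. **The category $s(\mathcal{Y},\Bbbk)$.** Objects are finite square block matrices $B=(B_i^j)_{i,j\in\mathcal{Y}}$ over $\Bbbk$ such that: (i) the horizontal and vertical partitions of $B$ are compatible; (ii) if $\sigma(i)=j$, then all matrices in $B_i$ (resp. $B^i$) have the same number of rows (resp. columns) as all matrices in $B_j$ (resp. $B^j$); (iii) $B^2=0$. A morphism $T:B\to C$ is a block matrix $T=(T_i^j)_{i,j\in\mathcal{Y}}$ over $\Bbbk$ such that: (a) the horizontal (resp. vertical) partition of $T$ is compatible with the vertical (resp. horizontal) partition of $B$ (resp. $C$); (b) $TC=BT$; (c) $T_i^j=0$ if $i>j$; (d) $T_i^i=T_j^j$ if $\sigma(i)=j$. Composition is matrix multiplication written in diagrammatic order: for $T:B\to C$ and $S:C\to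 D$ the composite is $TS:B\to D$. *)

(* Defs.v *)
From Stdlib Require Import FunctionalExtensionality ProofIrrelevance.
From mathcomp Require Import all_boot all_order all_algebra.

Set Implicit Arguments.
Unset Strict Implicit.
Unset Printing Implicit Defensive.

Import Order.TTheory GRing.Theory.

(* Composition is written in diagrammatic order: [comp f g] is f followed by
   g. *)
Record category := Category {
  ob :> Type;
  hom : ob -> ob -> Type;
  idm : forall a, hom a a;
  comp : forall a b c, hom a b -> hom b c -> hom a c;
  comp1m : forall a b (f : hom a b), comp (idm a) f = f;
  compm1 : forall a b (f : hom a b), comp f (idm b) = f;
  compA : forall a b c d (f : hom a b) (g : hom b c) (h : hom c d),
    comp f (comp g h) = comp (comp f g) h
}.

Arguments hom {c} : rename.
Arguments idm {c} : rename.
Arguments comp {c a b} {_} : rename.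

Declare Scope cat_scope.
Delimit Scope cat_scope with cat.
Notation "f ;; g" := (comp f g) (at level 50, left associativity) : cat_scope.
Local Open Scope cat_scope.

Definition mono (C : category) (a b : C) (f : hom a b) : Prop :=
  forall (x : C) (g h : hom x a), g ;; f = h ;; f -> g = h.

Definition epi (C : category) (a b : C) (f : hom a b) : Prop :=
  forall (x : C) (g h : hom b x), f ;; g = f ;; h -> g = h.

Definition zero_object (C : category) (z : C) : Prop :=
  forall a : C, (exists! f : hom z a, True) /\ (exists! f : hom a z, True).

Record preadditive (C : category) := Preadditive {
  zerom : forall a b : C, hom a b;
  oppm : forall a b : C, hom a b -> hom a b;
  addm : forall a b : C, hom a b -> hom a b -> hom a b;
  addmA : forall (a b : C) (f g h : hom a b),
    addm f (addm g h) = addm (addm f g) h;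
  addmC : forall (a b : C) (f g : hom a b), addm f g = addm g f;
  add0m : forall (a b : C) (f : hom a b), addm (zerom a b) f = f;
  addNm : forall (a b : C) (f : hom a b), addm (oppm f) f = zerom a b;
  compmDl : forall (a b c : C) (f g : hom a b) (h : hom b c),
    addm f g ;; h = addm (f ;; h) (g ;; h);
  compmDr : forall (a b c : C) (f : hom a b) (g h : hom b c),
    f ;; addm g h = addm (f ;; g) (f ;; h)
}.

Section Abelian.
Variables (C : category) (P : preadditive C).

Definition biproduct (a b c : C) (i1 : hom a c) (i2 : hom b c)
    (p1 : hom c a) (p2 : hom c b) : Prop :=
  [/\ i1 ;; p1 = idm a, i2 ;; p2 = idm b,
      i1 ;; p2 = zerom P a b, i2 ;; p1 = zerom P b a
    & addm P (p1 ;; i1) (p2 ;; i2) = idm c].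

Definition is_kernel (a b : C) (f : hom a b) (c : C) (k : hom c a) : Prop :=
  k ;; f = zerom P c b /\
  forall (x : C) (h : hom x a), h ;; f = zerom P x b ->
    exists! u : hom x c, u ;; k = h.

Definition is_cokernel (a b : C) (f : hom a b) (c : C) (q : hom b c) : Prop :=
  f ;; q = zerom P a c /\
  forall (x : C) (h : hom b x), f ;; h = zerom P a x ->
    exists! u : hom c x, q ;; u = h.

Definition additive_for : Prop :=
  (exists z : C, zero_object z) /\
  forall a b : C, exists (c : C) (i1 : hom a c) (i2 : hom b c)
    (p1 : hom c a) (p2 : hom c b), biproduct i1 i2 p1 p2.

Definition abelian_for : Prop :=
  [/\ additive_for,
      forall (a b : C) (f : hom a b), exists (c : C) (k : hom c a),
        is_kernel f k,
      forall (a b : C) (f : hom a b), exists (c : C) (q : hom b c),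
        is_cokernel f q,
      forall (c a : C) (k : hom c a), mono k ->
        exists (b : C) (f : hom a b), is_kernel f k
    & forall (b c : C) (q : hom b c), epi q ->
        exists (a : C) (f : hom a b), is_cokernel f q].

End Abelian.

(* The preadditive structure of an additive category is unique, so being
   abelian is a property of the bare category. *)
Definition is_abelian (C : category) : Prop :=
  exists P : preadditive C, abelian_for P.

Local Open Scope ring_scope.

Section BlockMatrices.
Variables (k : fieldType) (Y : finType).

(* Block matrices with block rows of heights m and block columns of widths n;
   [B i j] is the block in row i and column j. *)
Definition blockmx (m n : Y -> nat) := forall i j : Y, 'M[k]_(m i, n j).

Definition bmx0 m n : blockmx m n := fun i j => 0.

Definition bmx1 n : blockmx n n :=
  fun i j => \matrix_(r, c) ((i == j) && (r == c :> nat))%:R.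

Definition bmul m n p (A : blockmx m n) (B : blockmx n p) : blockmx m p :=
  fun i j => \sum_(l : Y) A i l *m B l j.

Lemma blockmxP m n (A B : blockmx m n) : (forall i j, A i j = B i j) -> A = B.
Proof.
move=> eqAB; apply: functional_extensionality_dep => i.
by apply: functional_extensionality_dep.
Qed.

Lemma bmx1_diag n i : bmx1 n i i = 1%:M.
Proof. by apply/matrixP => r c; rewrite !mxE eqxx. Qed.

Lemma bmx1_off n i j : i != j -> bmx1 n i j = 0.
Proof. by move/negPf=> ne; apply/matrixP => r c; rewrite !mxE ne. Qed.

Lemma bmul1m m n (A : blockmx m n) : bmul (bmx1 m) A = A.
Proof.
apply: blockmxP => i j; rewrite /bmul (bigD1 i) //= bmx1_diag mul1mx.
by rewrite big1 ?addr0 // => l ne; rewrite bmx1_off ?mul0mx // eq_sym.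
Qed.

Lemma bmulm1 m n (A : blockmx m n) : bmul A (bmx1 n) = A.
Proof.
apply: blockmxP => i j; rewrite /bmul (bigD1 j) //= bmx1_diag mulmx1.
by rewrite big1 ?addr0 // => l ne; rewrite bmx1_off ?mulmx0.
Qed.

Lemma bmulA m n p q (A : blockmx m n) (B : blockmx n p) (D : blockmx p q) :
  bmul A (bmul B D) = bmul (bmul A B) D.
Proof.
apply: blockmxP => i j; rewrite /bmul.
under eq_bigr do rewrite mulmx_sumr.
rewrite exchange_big /=; apply: eq_bigr => l _.
by rewrite mulmx_suml; apply: eq_bigr => l' _; rewrite mulmxA.
Qed.

End BlockMatrices.

Section SCategory.
Variables (k : fieldType) (disp : Order.disp_t) (Y : finOrderType disp).
Variable sigma : Y -> Y.

(* The single family sdim gives both the heights of the block rows and the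
   widths of the block columns, which is compatibility of the two partitions. *)
Record sobj := SObj {
  sdim : Y -> nat;
  smx : blockmx k sdim sdim;
  sdim_sigma : forall i j, sigma i = j -> sdim i = sdim j;
  smx_sq0 : bmul smx smx = bmx0 k sdim sdim
}.

Record is_smor (B C : sobj) (T : blockmx k (sdim B) (sdim C)) : Prop := IsSMor {
  smor_comm : bmul T (smx C) = bmul (smx B) T;
  smor_trig : forall i j, (j < i)%O -> T i j = 0;
  smor_sigma : forall i j (e : sigma i = j),
    castmx (sdim_sigma B e, sdim_sigma C e) (T i i) = T j j
}.

Record smor (B C : sobj) := SMor {
  smor_mx :> blockmx k (sdim B) (sdim C);
  smor_mxP : is_smor smor_mx
}.

Lemma smor_inj (B C : sobj) (T S : smor B C) :
  smor_mx T = smor_mx S -> T = S.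
Proof.
case: T S => T hT [S hS] /= eTS; case: S / eTS hS => hS.
by rewrite (proof_irrelevance _ hT hS).
Qed.

Lemma is_smor1 (B : sobj) : is_smor (bmx1 k (sdim B)).
Proof.
split=> [|i j lt_ji|i j e]; first by rewrite bmul1m bmulm1.
  by rewrite bmx1_off // gt_eqF.
rewrite !bmx1_diag; move: (sdim_sigma B e) => h.
by move: (sdim B j) h => d; case: d /; rewrite castmx_id.
Qed.

Lemma bmul_diag (B C D : sobj) (T : smor B C) (S : smor C D) i :
  bmul T S i i = smor_mx T i i *m smor_mx S i i.
Proof.
rewrite /bmul (bigD1 i) //= big1 ?addr0 // => l ne.
have [lt_li|lt_il|eq_li] := ltgtP l i.
- by rewrite (smor_trig (smor_mxP T) lt_li) mul0mx.
- by rewrite (smor_trig (smor_mxP S) lt_il) mulmx0.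
- by rewrite eq_li eqxx in ne.
Qed.

Lemma is_smorM (B C D : sobj) (T : smor B C) (S : smor C D) :
  is_smor (bmul T S).
Proof.
split=> [|i j lt_ji|i j e].
- by rewrite -bmulA (smor_comm (smor_mxP S)) !bmulA (smor_comm (smor_mxP T)).
- rewrite /bmul big1 // => l _; case: (ltP l i) => [lt_li|le_il].
    by rewrite (smor_trig (smor_mxP T) lt_li) mul0mx.
  by rewrite (smor_trig (smor_mxP S) (lt_le_trans lt_ji le_il)) mulmx0.
rewrite !bmul_diag -(smor_sigma (smor_mxP T) e) -(smor_sigma (smor_mxP S) e).
move: (smor_mx T i i) (smor_mx S i i) (sdim_sigma B e) (sdim_sigma C e) (sdim_sigma D e).
move: (sdim B j) (sdim C j) (sdim D j) => b c d M N eb ec ed.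
by case: b / eb; case: c / ec; case: d / ed; rewrite !castmx_id.
Qed.

Definition smor1 (B : sobj) : smor B B := SMor (is_smor1 B).

Definition smorM (B C D : sobj) (T : smor B C) (S : smor C D) : smor B D :=
  SMor (is_smorM T S).

Lemma smor1M (B C : sobj) (T : smor B C) : smorM (smor1 B) T = T.
Proof. by apply: smor_inj; apply: bmul1m. Qed.

Lemma smorM1 (B C : sobj) (T : smor B C) : smorM T (smor1 C) = T.
Proof. by apply: smor_inj; apply: bmulm1. Qed.

Lemma smorMA (A B C D : sobj) (T : smor A B) (S : smor B C) (R : smor C D) :
  smorM T (smorM S R) = smorM (smorM T S) R.
Proof. by apply: smor_inj; apply: bmulA. Qed.

Definition s_category : category := Category smor1M smorM1 smorMA.

End SCategory.

Arguments s_category k {disp Y} sigma.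

(* Main.v *)
(** An abelian category is balanced. Let [A] have blocks of sizes (1, 1, 0), let
    [B] have blocks of sizes (0, 0, 2), both with zero differential. The identity
    2x2 matrix is a morphism A -> B; being an invertible matrix, it is mono and
    epi. It has no inverse in the category, because every morphism B -> A lies
    below the diagonal and so vanishes. *)

From mathcomp Require Import all_boot all_order all_algebra.
Require Import Defs.

Set Implicit Arguments.
Unset Strict Implicit.
Unset Printing Implicit Defensive.

Import Order.TTheory GRing.Theory.
Local Open Scope cat_scope.

Lemma compm0 (C : category) (P : preadditive C) (a b c : C) (f : hom a b) :
  f ;; zerom P b c = zerom P a c.
Proof.
set z := f ;; _.
have zz : addm P z z = z by rewrite -compmDr add0m.
by rewrite -(add0m P z) -(addNm P z) -addmA zz.
Qed.

(** The mono [f] is a kernel of some [q]. Since [f ;; q] is zero and [f] is epi, [q] itself is zero,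
    so [idm b] factors through the kernel [f]. *)
Lemma abelian_mono_epi_retraction (C : category) (a b : C) (f : hom a b) :
  is_abelian C -> mono f -> epi f -> exists g : hom b a, g ;; f = idm b.
Proof.
move=> [P [_ _ _ kerP _]] /kerP [c [q [fq0 fker]]] fepi.
have q0 : q = zerom P b c by apply: fepi; rewrite fq0 compm0.
have [|g [gf _]] := fker b (idm b); last by exists g.
by rewrite comp1m.
Qed.

Local Open Scope ring_scope.

Lemma bmul0m (k : fieldType) (Y : finType) (m n p : Y -> nat)
    (A : blockmx k n p) : bmul (bmx0 k m n) A = bmx0 k m p.
Proof. by apply: blockmxP => i j; rewrite /bmul big1 // => l _; rewrite mul0mx. Qed.

Lemma bmulm0 (k : fieldType) (Y : finType) (m n p : Y -> nat)
    (A : blockmx k m n) : bmul A (bmx0 k n p) = bmx0 k m p.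
Proof. by apply: blockmxP => i j; rewrite /bmul big1 // => l _; rewrite mulmx0. Qed.

Section SCategory.
Variables (k : fieldType) (disp : Order.disp_t) (Y : finOrderType disp).
Variable sigma : Y -> Y.

(** [U] is only a block matrix and need not be a morphism: cancellation takes place among
    matrices. *)
Lemma smor_mono (B C : sobj k sigma) (T : smor B C)
    (U : blockmx k (sdim C) (sdim B)) :
  bmul T U = bmx1 k (sdim B) -> mono (C := s_category k sigma) T.
Proof.
move=> TU X g h /(congr1 (fun S : smor X C => bmul S U)) /= eqTU.
by apply: smor_inj; move: eqTU; rewrite -!bmulA TU !bmulm1.
Qed.

Lemma smor_epi (B C : sobj k sigma) (T : smor B C)
    (U : blockmx k (sdim C) (sdim B)) :
  bmul U T = bmx1 k (sdim C) -> epi (C := s_category k sigma) T.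
Proof.
move=> UT X g h /(congr1 (fun S : smor B X => bmul U S)) /= eqUT.
by apply: smor_inj; move: eqUT; rewrite !bmulA UT !bmul1m.
Qed.

Definition sobj0 (n : Y -> nat) (n_sigma : forall i j, sigma i = j -> n i = n j) :
  sobj k sigma := SObj n_sigma (bmul0m n (bmx0 k n n)).

End SCategory.

Section Counterexample.
Variables (k : fieldType) (disp : Order.disp_t) (Y : finOrderType disp).
Variables (a1 a2 a3 : Y) (sigma : Y -> Y).
Hypothesis Y_eq : forall y : Y, y \in [:: a1; a2; a3].
Hypothesis lt12 : (a1 < a2)%O.
Hypothesis lt23 : (a2 < a3)%O.
Hypothesis sigma_inv : involutive sigma.
Hypothesis sigma3 : sigma a3 = a3.

(** Both size functions depend only on whether [i] is [a3], which makes them invariant under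
    [sigma]. *)
Definition srcdim (i : Y) : nat := i != a3.
Definition tgtdim (i : Y) : nat := ((i == a3) * 2)%N.

(* The identity 2x2 matrix, cut into the rows (1 0) in block (a1, a3) and (0 1)
   in block (a2, a3). *)
Definition idblock : blockmx k srcdim tgtdim := fun i j =>
  \matrix_(r, c) [&& i != a3, j == a3 & c == (i == a2) :> nat]%:R.

(** The identity matrix again, now cut along the opposite partitions. Its nonzero blocks lie below
    the diagonal, so it is not a morphism. *)
Definition idblock_inv : blockmx k tgtdim srcdim := fun i j => (idblock j i)^T.

Lemma sigma_eq3 i j : sigma i = j -> (i == a3) = (j == a3).
Proof. by move=> <-; rewrite -{2}sigma3 (inj_eq (inv_inj sigma_inv)). Qed.

Lemma srcdim_sigma i j : sigma i = j -> srcdim i = srcdim j.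
Proof. by rewrite /srcdim => /sigma_eq3 ->. Qed.

Lemma tgtdim_sigma i j : sigma i = j -> tgtdim i = tgtdim j.
Proof. by rewrite /tgtdim => /sigma_eq3 ->. Qed.

Lemma le_a3 i : (i <= a3)%O.
Proof.
have:= Y_eq i; rewrite !inE => /or3P[] /eqP->; rewrite ?lexx //.
  exact: ltW (lt_trans lt12 lt23).
exact: ltW.
Qed.

Lemma idblock_diag i : idblock i i = 0.
Proof. by apply/matrixP => r c; rewrite !mxE; case: (i == a3). Qed.

Lemma idblock_mulV : bmul idblock idblock_inv = bmx1 k srcdim.
Proof.
apply: blockmxP => i j; apply/matrixP => r c; rewrite /bmul summxE mxE.
(* The existence of the index [r] rules out an empty block row. *)
have [i3 r0] : i != a3 /\ r = 0%N :> nat.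
  by move: r; rewrite /srcdim; case: (i != a3) => -[[]].
have [j3 c0] : j != a3 /\ c = 0%N :> nat.
  by move: c; rewrite /srcdim; case: (j != a3) => -[[]].
rewrite r0 c0 eqxx andbT (bigD1 a3) //= big1 ?addr0 => [|l /negPf l3]; last first.
  by rewrite mxE big1 // => s _; rewrite !mxE l3 /= andbF mul0r.
rewrite mxE; under eq_bigr => s _ do rewrite !mxE i3 j3 eqxx /=.
(* The sum over the block [a3] becomes a range of naturals, so that its two terms can be
   unfolded. *)
rewrite -(big_mkord xpredT (fun s => (s == (i == a2))%:R * (s == (j == a2))%:R)).
rewrite /tgtdim eqxx mul1n big_ltn // big_ltn // big_geq // addr0.
have := Y_eq i; rewrite !inE (negPf i3) orbF => /orP[] /eqP->.
  have := Y_eq j; rewrite !inE (negPf j3) orbF => /orP[] /eqP->.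
    by rewrite !eqxx (lt_eqF lt12) /= mulr1 mulr0 addr0.
  by rewrite !eqxx (lt_eqF lt12) /= mulr0 mul0r addr0.
have := Y_eq j; rewrite !inE (negPf j3) orbF => /orP[] /eqP->.
  by rewrite !eqxx (lt_eqF lt12) (gt_eqF lt12) /= mulr0 mul0r addr0.
by rewrite !eqxx /= mulr1 mulr0 add0r.
Qed.

Lemma idblock_mulVl : bmul idblock_inv idblock = bmx1 k tgtdim.
Proof.
apply: blockmxP => i j; apply/matrixP => r c; rewrite /bmul summxE mxE.
have [i3 r2] : i == a3 /\ (r < 2)%N.
  by move: r; rewrite /tgtdim; case: (i == a3) => -[].
have [j3 c2] : j == a3 /\ (c < 2)%N.
  by move: c; rewrite /tgtdim; case: (j == a3) => -[].
have a13 := lt_trans lt12 lt23.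
have entry l : (idblock_inv i l *m idblock l j) r c =
    ((l != a3) && (r == (l == a2) :> nat) && (c == (l == a2) :> nat))%:R.
  rewrite mxE; under eq_bigr => s _ do rewrite !mxE i3 j3 /=.
  (* The summand does not depend on [s], and [s] takes one value, or none when [l] is [a3]. *)
  rewrite sumr_const card_ord /srcdim; case: (l != a3); rewrite /= ?mulr0n //.
  by rewrite mulr1n -natrM mulnb.
under eq_bigr => l _ do rewrite entry.
rewrite (bigD1 a1) //= (bigD1 a2) ?(gt_eqF lt12) //= big1 => [|l /andP[l1 l2]].
  rewrite (lt_eqF lt12) (lt_eqF lt23) (lt_eqF a13) (_ : i == j);
    last by rewrite (eqP i3) eq_sym.
  rewrite !eqxx /= addr0.
  case: (nat_of_ord r) r2 => [|[]] // _; case: (nat_of_ord c) c2 => [|[]] // _;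
    by rewrite /= ?addr0 ?add0r.
by have := Y_eq l; rewrite !inE (negPf l1) (negPf l2) => /= ->.
Qed.

Let A := sobj0 k srcdim_sigma.
Let B := sobj0 k tgtdim_sigma.

Lemma idblock_smor : @is_smor k disp Y sigma A B idblock.
Proof.
split=> [|i j lt_ji|i j e]; first by rewrite bmulm0 bmul0m.
  apply/matrixP => r c; rewrite !mxE.
  (* From [j < i <= a3] it follows that [j] is not [a3], so the block is zero. *)
  by rewrite (lt_eqF (lt_le_trans lt_ji (le_a3 i))) andbF.
by rewrite !idblock_diag; apply/matrixP => r c; rewrite castmxE !mxE.
Qed.

(** In block [(a3, a3)] of the product every term vanishes: for [l < a3] because [S] is triangular,
    for [l = a3] because [idblock] has zero diagonal blocks. *)
Lemma idblock_no_retraction (S : smor B A) : bmul S idblock <> bmx1 k tgtdim.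
Proof.
move=> /(congr1 (fun M : blockmx k _ _ => M a3 a3)).
rewrite bmx1_diag /bmul big1 => [|l _].
  move=> /matrixP; rewrite {1 2}/tgtdim.
  (* The block is nonempty, so comparing its first entries gives [0 = 1]. *)
  have d3 : (0 < tgtdim a3)%N by rewrite /tgtdim eqxx.
  move=> /(_ (Ordinal d3) (Ordinal d3)) /eqP.
  by rewrite !mxE eqxx eq_sym oner_eq0.
have [->|l3] := eqVneq l a3; first by rewrite idblock_diag mulmx0.
by rewrite (smor_trig (smor_mxP S)) ?mul0mx // lt_neqAle l3 le_a3.
Qed.

Lemma s_category_not_abelian : ~ is_abelian (s_category k sigma).
Proof.
move=> abel; pose T := SMor idblock_smor.
have [] := abelian_mono_epi_retraction (f := T : @hom (s_category k sigma) A B) abel.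
- exact: (smor_mono (T := T) idblock_mulV).
- exact: (smor_epi (T := T) idblock_mulVl).
move=> S /(congr1 (@smor_mx k disp Y sigma B B)) /=.
exact: idblock_no_retraction.
Qed.

End Counterexample.

Theorem mainTheorem2 (k : fieldType) (disp : Order.disp_t)
    (Y : finOrderType disp) (a1 a2 a3 : Y)
    (Y_eq : forall y : Y, y \in [:: a1; a2; a3])
    (lt12 : (a1 < a2)%O) (lt23 : (a2 < a3)%O)
    (sigma : Y -> Y) (sigma_inv : involutive sigma)
    (sigma3 : sigma a3 = a3)
    (sigma12 : (sigma a1 = a1 /\ sigma a2 = a2) \/ sigma a1 = a2) :
  ~ is_abelian (s_category k sigma).
Proof. exact: s_category_not_abelian Y_eq lt12 lt23 sigma_inv sigma3. Qed.
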